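(* For prime powers $q\equiv1\pmod 4$, let $m(q)=\min\{|S|: S\text{ is an identifying set in the Paley graph }P(q)\}$. Then $m(q)=\Theta(\log q)$ as $q\to\infty$; that is, there exist constants $0<c\le C$ such that $c\log q\le m(q)\le C\log q$ for all sufficiently large such $q$.
   Context: All graphs are finite, simple and undirected. For a prime power $q\equiv1\pmod 4$, the Paley graph $P(q)$ has as vertex set the finite field $F_q$, with distinct $i,j$ adjacent if and only if $i-j$ is a nonzero square in $F_q$. For a graph $G=(V,E)$ and $x\in V$, $N[x]=\{x\}\cup\{y: xy\in E\}$. A set $C\subseteq V$ is identifying if $N[x]\cap C\ne\emptyset$ for every $x\in V$ and $N[x]\cap C\neq N[y]\cap C$ for all distinct $x,y\in V$. *)

(* Defs.v *)
From mathcomp Require Import all_boot all_order all_algebra all_field.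
From mathcomp Require Import all_reals.
From mathcomp Require Import exp.
From mathcomp Require Import ring.

Set Implicit Arguments.
Unset Strict Implicit.
Unset Printing Implicit Defensive.

Import Order.TTheory GRing.Theory Num.Theory.
Local Open Scope ring_scope.

Section Identifying.

Variables (V : finType) (adj : rel V).

Definition closed_nbhd (x : V) : {set V} := [set y | (y == x) || adj x y].

Definition identifying (C : {set V}) : bool :=
  [forall x, closed_nbhd x :&: C != set0] &&
  [forall x, forall y,
     (x != y) ==> (closed_nbhd x :&: C != closed_nbhd y :&: C)].

(* A graph with two vertices having the same closed neighbourhood has no
   identifying set, and then the value is the junk value #|V|.  By
   identifying_paley below this does not happen for Paley graphs, where
   identifying_numberP shows that the value is the genuine minimum. *)
Definition identifying_number : nat :=
  #|[arg min_(C < [set: V] | identifying C) #|C| ]|.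

Lemma identifying_numberP (C0 : {set V}) : identifying C0 ->
  (exists2 C : {set V}, identifying C & #|C| = identifying_number) /\
  (forall C : {set V}, identifying C -> (identifying_number <= #|C|)%N).
Proof.
move=> idC0; have idT : identifying [set: V].
  case/andP: idC0 => /forallP dom /forallP sep; apply/andP; split.
    apply/forallP=> x; apply: contraNneq (dom x).
    by rewrite setIT => ->; rewrite set0I.
  apply/forallP=> x; apply/forallP=> y; apply/implyP=> xy.
  have /implyP/(_ xy) := forallP (sep x) y.
  by apply: contraNneq; rewrite !setIT => ->.
by rewrite /identifying_number; case: arg_minnP => // C idC minC; split;
  [exists C |].
Qed.

End Identifying.

(* For #|F| = 1 %[mod 4] this relation is irreflexive and symmetric: see
   paley_irr and paley_sym. *)
Definition paley (F : finFieldType) : rel F :=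
  fun x y => (x - y != 0) && [exists z : F, x - y == z ^+ 2].

Section Paley.

Variable F : finFieldType.
Hypothesis F1 : (#|F| = 1 %[mod 4])%N.

Lemma paley_irr : irreflexive (@paley F).
Proof. by move=> x; rewrite /paley subrr eqxx. Qed.

Lemma finField_sqrtN1 :
  exists2 i : F, i ^+ 2 = -1 & (1 : F) != -1.
Proof.
have Fgt1 := finNzRing_gt1 F.
pose k := (#|F| %/ 4)%N.
have cF : #|F| = (k * 4).+1.
  by rewrite {1}(divn_eq #|F| 4) F1 addn1.
have k_gt0 : (0 < k)%N by case: (k) cF Fgt1 => // ->.
have x4k (x : F) : x != 0 -> x ^+ (k * 4) = 1.
  by move=> x0; apply: (mulfI x0); rewrite mulr1 -exprS -cF expf_card.
have [x /andP[x0 x2k]|no] := pickP [pred x : F | (x != 0) && (x ^+ (k * 2) != 1)].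
  have /eqP : (x ^+ (k * 2)) ^+ 2 = 1 by rewrite -exprM -mulnA x4k.
  rewrite sqrf_eq1 (negbTE x2k) /= => /eqP x2kN.
  exists (x ^+ k); first by rewrite -exprM.
  by rewrite -x2kN eq_sym.
pose p : {poly F} := 'X^(k * 2) - 1.
have k2_gt0 : (0 < k * 2)%N by rewrite muln_gt0 k_gt0.
have sp : size p = (k * 2).+1 by rewrite size_XnsubC.
have p0 : p != 0 by rewrite -size_poly_eq0 sp.
have : (size (enum [set~ (0%R : F)]) < size p)%N.
  apply: max_poly_roots; rewrite ?enum_uniq //.
  apply/allP=> x; rewrite mem_enum in_setC1 => x0.
  have := no x; rewrite /= x0 /= => /negbFE/eqP xk.
  by rewrite /root /p !hornerE xk subrr.
by rewrite sp -cardE cardsC1 cF /= ltnS leq_pmul2l.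
Qed.

Lemma paley_sym : symmetric (@paley F).
Proof.
have [i i2 _] := finField_sqrtN1.
suff half (x y : F) : paley x y -> paley y x by move=> x y; apply/idP/idP; apply: half.
rewrite /paley -[x - y]opprB oppr_eq0 => /andP[-> /existsP[z /eqP zE]] /=.
apply/existsP; exists (i * z).
by rewrite exprMn i2 mulN1r -zE opprK.
Qed.

Lemma identifying_paley : identifying (@paley F) [set: F].
Proof.
apply/andP; split.
  apply/forallP=> x; rewrite setIT; apply/set0Pn.
  by exists x; rewrite inE eqxx.
apply/forallP=> x; apply/forallP=> y; apply/implyP=> xy.
rewrite !setIT; apply/eqP=> Nxy.
have [i i2 two0] := finField_sqrtN1.
pose sq (z : F) := [exists w : F, z == w ^+ 2].
have mem_nbhd u v : (v \in closed_nbhd (@paley F) u) = sq (u - v).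
  rewrite inE /paley subr_eq0 [v == u]eq_sym; have [->|//] := eqVneq u v.
  rewrite subrr; apply/esym/existsP; exists 0; by rewrite expr0n.
have step u : sq u -> sq (y - x + u).
  have <- : y - (x - u) = y - x + u by ring.
  by rewrite -mem_nbhd -Nxy mem_nbhd; congr (sq _); ring.
have /existsP[a /eqP aE] : sq (y - x).
  rewrite -[y - x]addr0; apply: step; apply/existsP; exists 0.
  by rewrite expr0n.
have a0 : a != 0 by rewrite -sqrf_eq0 -aE subr_eq0 eq_sym.
have sqD b v : sq (v ^+ 2 + b ^+ 2).
  have [->|v0] := eqVneq v 0.
    by apply/existsP; exists b; rewrite expr0n add0r.
  have /step/existsP[w /eqP wE] : sq ((b * a / v) ^+ 2).
    by apply/existsP; exists (b * a / v).
  apply/existsP; exists (v / a * w); rewrite exprMn -wE aE; apply/eqP.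
  by field; rewrite a0 v0.
have two1 : (2%:R : F) != 0 by rewrite (natrD _ 1 1) addr_eq0.
have all_sq u : sq u.
  suff <- : ((u + 1) / 2%:R) ^+ 2 + (i * ((u - 1) / 2%:R)) ^+ 2 = u by [].
  by rewrite [(i * _) ^+ 2]exprMn i2; field.
pose root (u : F) : F := odflt 0 [pick w | u == w ^+ 2].
have rootK : cancel root (fun w => w ^+ 2).
  move=> u; rewrite /root; case: pickP => [w /eqP //|no].
  by have /existsP[w] := all_sq u; rewrite no.
have /bij_inj sq_inj : bijective (fun w : F => w ^+ 2).
  have [g gK Kg] := injF_bij (can_inj rootK).
  exists root => // w; rewrite -{1}[w]Kg rootK; exact: Kg.
by have /eqP := sq_inj 1 (-1) (esym (sqrrN 1)); apply/negP.
Qed.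

End Paley.

(* Main.v *)
(* Lower bound: the traces N[x] :&: C are q distinct subsets of C, so
   q <= 2 ^ |C|.  Upper bound: C is identifying as soon as it meets every N[x]
   and every symmetric difference of N[x] and N[y].  For x != y and a nonsquare
   u, the unique z with x - z = u (y - z) lies in exactly one of N[x] and N[y],
   so all these q ^ 2 sets have at least (q - 1) / 2 >= q / 3 elements.  By
   averaging, some vertex hits a third of the sets not yet hit; choosing such
   vertices greedily, O(log q) of them suffice. *)
Require Import Defs.
From mathcomp Require Import all_boot all_order all_algebra all_field.
From mathcomp Require Import all_reals.
From mathcomp Require Import exp.
From mathcomp Require Import zify ring.

Set Implicit Arguments.
Unset Strict Implicit.
Unset Printing Implicit Defensive.

Import Order.TTheory GRing.Theory Num.Theory.
Local Open Scope ring_scope.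

(** * Greedy hitting sets for families of large sets *)

Section Greedy.

Variables (T I : finType) (A : I -> {set T}).
Hypothesis T_gt0 : (0 < #|T|)%N.
Hypothesis A_large : forall i, (#|T| <= 3 * #|A i|)%N.

Lemma popular_point (J : {set I}) :
  exists t, (#|J| <= 3 * #|[set i in J | t \in A i]|)%N.
Proof.
apply/existsP; apply: contraT => /existsPn few.
have: (\sum_(t : T) 3 * #|[set i in J | t \in A i]| < \sum_(t : T) #|J|)%N.
  have /card_gt0P[t0 _] := T_gt0.
  have few' t : (3 * #|[set i in J | t \in A i]| < #|J|)%N by rewrite ltnNge few.
  (* Splitting off one point keeps the inequality of sums strict; this is where [T] must be
     nonempty. *)
  rewrite (bigD1 t0) //= [X in (_ < X)%N](bigD1 t0) //= -addSn.
  by apply: leq_add => //; apply: leq_sum => t _; apply: ltnW.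
rewrite ltnNge => /negP[]; rewrite sum_nat_const mulnC -big_distrr /=.
have -> : (\sum_(t : T) #|[set i in J | t \in A i]| = \sum_(i in J) #|A i|)%N.
  under eq_bigr => t _ do rewrite -sum1dep_card big_mkcondr /=.
  rewrite exchange_big /=; apply: eq_bigr => i _.
  by rewrite -big_mkcond sum1_card.
by rewrite big_distrr /= -sum_nat_const; apply: leq_sum => i _.
Qed.

(** A popular point leaves at most two thirds of [J] unhit, so the hypothesis, read as |J| (2/3)^k <
    1, passes from [k.+1] to [k]; at [k = 0] it forces [J] to be empty. *)
Lemma greedy_hitting_set (k : nat) (J : {set I}) :
  (#|J| * 2 ^ k < 3 ^ k)%N ->
  exists2 C : {set T}, (#|C| <= k)%N &
    forall i, i \in J -> A i :&: C != set0.
Proof.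
elim: k J => [|k IHk] J hJ.
  exists set0; first by rewrite cards0.
  move: hJ; rewrite muln1 expn0 ltnS leqn0 cards_eq0 => /eqP -> i.
  by rewrite inE.
have [t ht] := popular_point J.
pose J' := [set i in J | t \notin A i].
have cJ : (#|[set i in J | t \in A i]| + #|J'| = #|J|)%N.
  rewrite -(cardsID [set i | t \in A i] J); congr (_ + _)%N.
    by apply: eq_card => i; rewrite !inE.
  by apply: eq_card => i; rewrite !inE andbC.
have /IHk[C Ck hC] : (#|J'| * 2 ^ k < 3 ^ k)%N.
  have le23 : (3 * #|J'| <= 2 * #|J|)%N by lia.
  rewrite -(@ltn_pmul2l 3) // -expnS; apply: leq_ltn_trans hJ.
  by rewrite mulnA expnS mulnA [(#|J| * 2)%N]mulnC leq_mul2r le23 orbT.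
exists (t |: C).
  by rewrite cardsU1 (leq_trans (leq_add (leq_b1 _) Ck)).
move=> i iJ; apply/set0Pn.
have [tA|tNA] := boolP (t \in A i); first by exists t; rewrite !inE tA eqxx.
have /hC/set0Pn[s] : i \in J' by rewrite inE iJ.
by rewrite inE => /andP[sA sC]; exists s; rewrite !inE sA sC orbT.
Qed.

End Greedy.

(** * Identifying sets: counting traces, and reduction to hitting sets *)

Section Identifying.

Variables (V : finType) (adj : rel V).
Local Notation N := (closed_nbhd adj).

Lemma card_le_exp2_identifying (C : {set V}) :
  identifying adj C -> (#|V| <= 2 ^ #|C|)%N.
Proof.
case/andP=> _ /forallP sep; rewrite -card_powerset.
have injN : injective (fun x => N x :&: C).
  move=> x y /eqP eqN; apply/eqP; apply: contraLR eqN => xy.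
  by have /forallP/(_ y)/implyP/(_ xy) := sep x.
rewrite -cardsT -(card_imset _ injN); apply: subset_leq_card.
by apply/subsetP=> _ /imsetP[x _ ->]; rewrite powersetE subsetIr.
Qed.

(* The diagonal carries the domination condition. *)
Definition separator (p : V * V) : {set V} :=
  if p.1 == p.2 then N p.1 else [set z | (z \in N p.1) (+) (z \in N p.2)].

Lemma separator_hitting_identifying (C : {set V}) :
  (forall p, separator p :&: C != set0) -> identifying adj C.
Proof.
move=> hit; apply/andP; split; apply/forallP=> x.
  by have := hit (x, x); rewrite /separator eqxx.
apply/forallP=> y; apply/implyP=> xy.
have := hit (x, y); rewrite /separator /= (negbTE xy).
case/set0Pn=> z /setIP[]; rewrite inE => zxy zC.
apply: contraTneq zxy => /setP/(_ z); rewrite !in_setI zC !andbT => ->.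
by rewrite addbb.
Qed.

End Identifying.

(** * Quadratic residues and separators in Paley graphs *)

Section PaleySeparators.

Variable F : finFieldType.
Hypothesis F1 : (#|F| = 1 %[mod 4])%N.
Local Notation N := (closed_nbhd (@paley F)).
(** The exponent in Euler's criterion: u |-> u ^ e is the quadratic character. *)
Local Notation e := (#|F|.-1)./2.

Let cardF : #|F| = (e.*2).+1.
Proof. by move: (#|F|) F1 (finNzRing_gt1 F) => q; lia. Qed.

Let e_gt0 : (0 < e)%N.
Proof. by move: (#|F|) F1 (finNzRing_gt1 F) => q; lia. Qed.

Let nzsquares : {set F} := [set z ^+ 2 | z in [set~ (0 : F)]].

Lemma expf_half_sq (u : F) : u != 0 -> (u ^+ e) ^+ 2 = 1.
Proof.
move=> u0; apply: (mulfI u0).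
by rewrite mulr1 -exprM muln2 -exprS -cardF expf_card.
Qed.

Lemma card_expf_half : (#|[set u : F | u ^+ e == 1%R]| <= e)%N.
Proof.
pose p : {poly F} := 'X^e - 1.
have sp : size p = e.+1 by rewrite size_XnsubC.
have p0 : p != 0 by rewrite -size_poly_eq0 sp.
rewrite -ltnS -sp cardE; apply: max_poly_roots; rewrite ?enum_uniq //.
apply/allP=> u; rewrite mem_enum inE => /eqP ue.
by rewrite /root /p !hornerE ue subrr.
Qed.

(** Squaring maps the 2e nonzero elements at most two to one. *)
Lemma card_nzsquares : (e <= #|nzsquares|)%N.
Proof.
have : (#|[set~ (0%R : F)]| <= \sum_(s in nzsquares) 2)%N.
  rewrite -sum1_card (partition_big (fun z => z ^+ 2) (mem nzsquares)) /=.
    apply: leq_sum => s /imsetP[z _ ->].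
    rewrite sum1dep_card; apply: leq_trans (_ : #|[set z; - z]| <= 2)%N.
      apply/subset_leq_card/subsetP=> w; rewrite !inE => /andP[_].
      by rewrite eqf_sqr.
    by rewrite cards2; case: (_ != _).
  by move=> z z0; apply: imset_f.
by rewrite cardsC1 sum_nat_const {1}cardF; lia.
Qed.

(** Nonzero squares are roots of X^e - 1, which has at most e roots, and there are at least e such
    squares. *)
Lemma euler_criterion : nzsquares = [set u : F | u ^+ e == 1].
Proof.
apply/eqP; rewrite eqEcard (leq_trans card_expf_half card_nzsquares) andbT.
apply/subsetP=> _ /imsetP[z z0 ->]; rewrite inE -exprM mulnC exprM.
by rewrite expf_half_sq //; move: z0; rewrite !inE.
Qed.

Lemma mem_paley_nbhd (x z : F) :
  (z \in N x) = (x - z == 0) || ((x - z) ^+ e == 1).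
Proof.
have -> : ((x - z) ^+ e == 1) = (x - z \in nzsquares).
  by rewrite euler_criterion inE.
rewrite inE /paley subr_eq0 [z == x]eq_sym.
have [//|xz] := eqVneq x z => /=.
apply/existsP/imsetP => [[w /eqP wE]|[w _ ->]]; exists w => //.
by rewrite !inE -sqrf_eq0 -wE subr_eq0.
Qed.

Lemma card_paley_separator (p : F * F) :
  (e <= #|separator (@paley F) p|)%N.
Proof.
case: p => x y; rewrite /separator /=; have [_|xy] := eqVneq x y.
  apply: leq_trans card_nzsquares _.
  rewrite -(card_imset _ (can_inj (subKr x))).
  apply/subset_leq_card/subsetP=> _ /imsetP[u + ->].
  by rewrite euler_criterion inE mem_paley_nbhd subKr => ->; rewrite orbT.
pose nonsq : {set F} := [set u | (u != 0) && (u ^+ e != 1)].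
have nonsq_card : (e <= #|nonsq|)%N.
  pose roots : {set F} := [set u | u ^+ e == 1].
  have roots_card : (#|roots| <= e)%N := card_expf_half.
  have /subset_leq_card : [set: F] \subset 0 |: (nonsq :|: roots).
    by apply/subsetP=> u _; rewrite !inE; case: (u == 0); case: (_ == 1).
  rewrite cardsT cardsU1 {1}cardF => cover.
  have cU : (#|nonsq :|: roots| <= #|nonsq| + #|roots|)%N.
    exact: leq_card_setU.
  have := leq_trans cover (leq_add (leq_b1 _) cU).
  by rewrite add1n ltnS; move: roots_card; lia.
have neq1 u : u \in nonsq -> u - 1 != 0.
  rewrite inE subr_eq0 => /andP[_].
  by apply: contraNneq => ->; rewrite expr1n.
(* [f u] is the solution z of x - z = u (y - z). For a nonsquare u the characters of x - z and y - z
   are then opposite, so z lies in exactly one of the two neighbourhoods. *)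
pose f (u : F) := y - (x - y) / (u - 1).
have xy0 : x - y != 0 by rewrite subr_eq0.
have f_inj : {in nonsq &, injective f}.
  move=> u v _ _ /addrI/oppr_inj/(mulfI xy0)/invr_inj.
  exact: addIr.
apply: leq_trans nonsq_card _; rewrite -(card_in_imset f_inj).
apply/subset_leq_card/subsetP=> _ /imsetP[u uns ->].
have u1 := neq1 u uns.
have yf : y - f u = (x - y) / (u - 1) by rewrite /f subKr.
have xf : x - f u = u * (y - f u) by rewrite yf /f; field.
have yf0 : y - f u != 0 by rewrite yf mulf_neq0 ?invr_eq0.
move: uns; rewrite inE => /andP[u0 ue].
have ueN : u ^+ e = -1.
  by have /eqP := expf_half_sq u0; rewrite sqrf_eq1 (negbTE ue) => /eqP.
have m1 : (1 : F) != -1 by have [] := finField_sqrtN1 F1.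
rewrite inE !mem_paley_nbhd xf mulf_eq0 (negbTE u0) (negbTE yf0) /= exprMn ueN.
have /eqP := expf_half_sq yf0; rewrite sqrf_eq1 => /orP[]/eqP ->.
  by rewrite mulr1 eqxx [-1 == 1]eq_sym (negbTE m1).
by rewrite mulrNN mulr1 eqxx [-1 == 1]eq_sym (negbTE m1).
Qed.

Lemma paley_identifying_log :
  exists2 C : {set F}, identifying (@paley F) C &
    (#|C| <= 4 * (trunc_log 2 #|F|).+1)%N.
Proof.
set m := (trunc_log 2 #|F|).+1.
have F_gt0 : (0 < #|F|)%N by rewrite cardF.
(* q = 2e + 1 <= 3e, as e is positive. *)
have large p : (#|F| <= 3 * #|separator (@paley F) p|)%N.
  by have := card_paley_separator p; have := cardF; have := e_gt0; lia.
have enough : (#|[set: F * F]| * 2 ^ (4 * m) < 3 ^ (4 * m))%N.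
  rewrite cardsT card_prod.
  have Fm : (#|F| < 2 ^ m)%N by apply: trunc_log_ltn.
  apply: (@leq_trans (2 ^ m * 2 ^ m * 2 ^ (4 * m))%N).
    by rewrite ltn_pmul2r ?expn_gt0 // ltn_mul.
  (* The factor 4 in the number of rounds suffices because 2 * 2 * 2^4 = 64 <= 81 = 3^4. *)
  by rewrite (expnM 2) (expnM 3) -!expnMn leq_exp2r.
have [C Cm hit] := greedy_hitting_set F_gt0 large enough.
exists C => //; apply: separator_hitting_identifying => p; exact: hit.
Qed.

End PaleySeparators.

(** * Passage to natural logarithms *)

Theorem theorem33 (R : realType) :
  exists c C : R, (0 < c <= C) /\
    exists q0 : nat, forall (q : nat) (F : finFieldType),
      #|F| = q -> (q = 1 %[mod 4])%N -> (q0 <= q)%N ->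
      c * ln (q%:R) <= (identifying_number (@paley F))%:R <= C * ln (q%:R).
Proof.
have ln2_gt0 : 0 < ln (2 : R) by apply: ln_gt0; rewrite ltr1n.
have ln2_le1 : ln (2 : R) <= 1.
  by have := @le_ln1Dx R 1 (lt_trans (ltrN10 _) ltr01).
(* Below, ln q <= |C| ln 2 <= |C|. Above, with l the integer part of the binary logarithm of q, 4 (l
   + 1) <= 8 l since l >= 1, and l ln 2 <= ln q. Both bounds hold from q0 = 0 on. *)
exists 1, (8 / ln 2); split.
  by rewrite ltr01 ler_pdivlMr // mul1r (le_trans ln2_le1) // ler1n.
exists 0%N => q F cF q1 _; rewrite -cF in q1.
have q_gt1 : (1 < q)%N by rewrite -cF finNzRing_gt1.
have lnXn2 n : ln ((2 ^ n)%:R : R) = n%:R * ln 2.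
  by rewrite natrX lnXn // mulr_natl.
have [[C idC cC] minC] := identifying_numberP (identifying_paley q1).
apply/andP; split.
  rewrite mul1r -cC.
  have : ln (q%:R : R) <= #|C|%:R * ln 2.
    rewrite -lnXn2 ler_ln ?posrE ?ltr0n ?expn_gt0 ?(ltnW q_gt1) //.
    by rewrite ler_nat -cF (card_le_exp2_identifying idC).
  by move/le_trans; apply; rewrite ler_piMr.
have [D idD] := paley_identifying_log q1.
rewrite cF; set l := trunc_log 2 q => cD.
have l_gt0 : (0 < l)%N by rewrite trunc_log_gt0.
have ql : l%:R * ln 2 <= ln (q%:R : R).
  rewrite -lnXn2 ler_ln ?posrE ?ltr0n ?expn_gt0 ?(ltnW q_gt1) //.
  by rewrite ler_nat trunc_logP // ltnW.
have le8l : (identifying_number (@paley F) <= 8 * l)%N.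
  by apply: leq_trans (minC _ idD) _; lia.
apply: (@le_trans _ _ (8 * l)%:R); first by rewrite ler_nat.
by rewrite natrM -mulrA ler_wpM2l // mulrC ler_pdivlMr.
Qed.
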